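(* Let $C=\mathbb{R}^n$, and let $f,g,\phi:\mathbb{R}^n\to(-\infty,+\infty]$ and $\Psi=f+g$ satisfy Assumptions (A), (B), (C), (D), (E) listed in the context. Suppose that $\Psi$ is a KL function. Let $\{\bm{x}^k\}_{k=0}^\infty$ be a sequence generated by the algorithm ABPG (described in the context) for solving $\min_{\bm{x}\in\mathbb{R}^n}\Psi(\bm{x})$. Then the following statements hold when $g\equiv0$: (i) $\lim_{k\to\infty}\operatorname{dist}(\bm{0},\partial\Psi(\bm{x}^k))=0$. (ii) The sequence $\{\bm{x}^k\}_{k=0}^\infty$ converges to a stationary point of the problem, i.e., to a point $\tilde{\bm{x}}$ with $\bm{0}\in\partial\Psi(\tilde{\bm{x}})$; moreover, $\sum_{k=1}^\infty\|\bm{x}^k-\bm{x}^{k-1}\|<\infty$.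
   Context: Problem: minimize $\Psi(\bm{x}):=f(\bm{x})+g(\bm{x})$ over $\bm{x}\in\operatorname{cl}C$, where $C\subset\mathbb{R}^n$ is a nonempty open convex set; in this statement $C=\mathbb{R}^n$. Kernel generating distances: $\mathcal{G}(C)$ is the class of functions $\phi:\mathbb{R}^n\to(-\infty,+\infty]$ that are proper, lower semicontinuous and convex, with $\operatorname{dom}\phi\subset\operatorname{cl}C$, $\operatorname{dom}\partial\phi=C$, and $\phi$ is $\mathcal{C}^1$ on $\operatorname{int}\operatorname{dom}\phi=C$. $L$-smooth adaptable ($L$-smad): for $\phi\in\mathcal{G}(C)$ and $f:\mathbb{R}^n\to(-\infty,+\infty]$ proper and lower semicontinuous with $\operatorname{dom}\phi\subset\operatorname{dom}f$ and $f$ of class $\mathcal{C}^1$ on $C$, the pair $(f,\phi)$ is $L$-smad on $C$, with $L>0$, if $L\phi-f$ and $L\phi+f$ are convex on $C$. Assumption (A): (i) $\phi\in\mathcal{G}(C)$ with $\operatorname{cl}C=\operatorname{cl}\operatorname{dom}\phi$ is $\mathcal{C}^2$ on $C=\operatorname{int}\operatorname{dom}\phi$. (ii) $f:\mathbb{R}^n\to(-\infty,+\infty]$ is proper and lower semicontinuous with $\operatorname{dom}\phi\subset\operatorname{dom}f$, and is $\mathcal{C}^1$ on $C$. (iii) $g:\mathbb{R}^n\to(-\infty,+\infty]$ is proper and convex with $\operatorname{dom}g\cap C\neq\emptyset$. (iv) $\Psi^*:=\inf_{\bm{x}\in\operatorname{cl}C}\Psi(\bm{x})>-\infty$. (v)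 For any $\bm{x}\in\operatorname{int}\operatorname{dom}\phi$ and $\lambda>0$, the function $\bm{u}\mapsto\lambda g(\bm{u})+\frac12\langle\nabla^2\phi(\bm{x})(\bm{u}-\bm{x}),\bm{u}-\bm{x}\rangle$ is supercoercive: its value divided by $\|\bm{u}\|$ tends to $\infty$ as $\|\bm{u}\|\to\infty$. Assumption (B): for any $\bm{x}\in C$ and $\lambda>0$, $\tilde{\mathcal{T}}_\lambda(\bm{x})\subset C$, where $\tilde{\mathcal{T}}_\lambda(\bm{x}):=\operatorname{argmin}_{\bm{u}\in\operatorname{cl}C}\{\langle\nabla f(\bm{x}),\bm{u}-\bm{x}\rangle+g(\bm{u})+\frac{1}{2\lambda}\langle\nabla^2\phi(\bm{x})(\bm{u}-\bm{x}),\bm{u}-\bm{x}\rangle\}$. Assumption (C): the pair $(f,\phi)$ is $L$-smad on $C$ for some $L>0$. Assumption (D): $\phi$ is $\sigma$-strongly convex on $C$ for some $\sigma>0$. Assumption (E): (i) $\nabla f$ and $\nabla\phi$ are Lipschitz continuous on any bounded subset of $\mathbb{R}^n$; (ii) $\Psi$ is level-bounded, i.e., for every $r\in\mathbb{R}$ the set $\{\bm{x}\in\mathbb{R}^n\mid\Psi(\bm{x})\le r\}$ is bounded. Algorithm ABPG: choose $\bm{x}^0\in\operatorname{int}\operatorname{dom}\phi$, $\eta\in(0,1)$, $\alpha\in(0,1)$, $\lambda>0$. For $k=0,1,2,\dots$: compute $\bm{d}^k=\operatorname{argmin}_{\bm{d}:\,\bm{x}^k+\bm{d}\in\operatorname{cl}C}\{\langle\nabla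 f(\bm{x}^k),\bm{d}\rangle+g(\bm{x}^k+\bm{d})+\frac{1}{2\lambda}\langle\nabla^2\phi(\bm{x}^k)\bm{d},\bm{d}\rangle\}$; set $t_k=1$, and while $\Psi(\bm{x}^k+t_k\bm{d}^k)>\Psi(\bm{x}^k)+\alpha t_k(\langle\nabla f(\bm{x}^k),\bm{d}^k\rangle+g(\bm{x}^k+\bm{d}^k)-g(\bm{x}^k))$ replace $t_k$ by $\eta t_k$; then set $\bm{x}^{k+1}=\bm{x}^k+t_k\bm{d}^k$. $\partial$ denotes the limiting subdifferential: for proper lower semicontinuous $h$, $\hat\partial h(\bm{x})=\{\bm{\xi}\mid\liminf_{\bm{y}\to\bm{x},\bm{y}\ne\bm{x}}\frac{h(\bm{y})-h(\bm{x})-\langle\bm{\xi},\bm{y}-\bm{x}\rangle}{\|\bm{x}-\bm{y}\|}\ge0\}$ for $\bm{x}\in\operatorname{dom}h$ (empty otherwise), and $\partial h(\bm{x})$ is the set of limits $\bm{\xi}$ of sequences $\bm{\xi}^k\in\hat\partial h(\bm{y}^k)$ with $\bm{y}^k\to\bm{x}$, $h(\bm{y}^k)\to h(\bm{x})$. $\operatorname{dist}(\bm{x},S)=\inf_{\bm{y}\in S}\|\bm{x}-\bm{y}\|$; $\operatorname{dom}\partial h=\{\bm{x}\mid\partial h(\bm{x})\ne\emptyset\}$. KL property: for $\varepsilon>0$, let $\Xi_\varepsilon$ be the set of continuous concave functions $\psi:[0,\varepsilon)\to\mathbb{R}_+$ that are $\mathcal{C}^1$ on $(0,\varepsilon)$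 with positive derivative and satisfy $\psi(0)=0$. A proper lower semicontinuous function $h$ has the Kurdyka--\L ojasiewicz (KL) property at $\hat{\bm{x}}\in\operatorname{dom}\partial h$ if there exist $\varepsilon\in(0,+\infty]$, a neighborhood $U$ of $\hat{\bm{x}}$, and $\psi\in\Xi_\varepsilon$ such that $\psi'(h(\bm{x})-h(\hat{\bm{x}}))\operatorname{dist}(\bm{0},\partial h(\bm{x}))\ge1$ for all $\bm{x}\in U$ with $h(\hat{\bm{x}})<h(\bm{x})<h(\hat{\bm{x}})+\varepsilon$. It is a KL function if it has the KL property at each point of $\operatorname{dom}\partial h$. *)

(* Defs.v *)
From HB Require Import structures.
From mathcomp Require Import all_boot all_order all_algebra.
From mathcomp Require Import all_classical all_reals all_analysis.

Set Implicit Arguments.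
Unset Strict Implicit.
Unset Printing Implicit Defensive.

Import Order.TTheory GRing.Theory Num.Theory.
Import numFieldNormedType.Exports.

Local Open Scope classical_set_scope.
Local Open Scope ring_scope.

(* R^n is 'rV[R]_n. Its library norm `|x| is the sup norm: it is only used
   through notions that do not depend on the choice of a norm (topology,
   limits, differentiability, boundedness). The norm of R^n is enorm. *)

Definition dot {R : realType} {n : nat} (u v : 'rV[R]_n) : R :=
  \sum_(i < n) u ord0 i * v ord0 i.

Definition enorm {R : realType} {n : nat} (u : 'rV[R]_n) : R :=
  Num.sqrt (dot u u).

Definition grad {R : realType} {n : nat} (h : 'rV[R]_n -> \bar R)
    (x : 'rV[R]_n) : 'rV[R]_n :=
  \row_(i < n) 'D_(delta_mx ord0 i) (fun y => fine (h y)) x.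

(* (hess h x) i j is the i-th partial derivative of the j-th component of the
   gradient; jacobians act on row vectors from the right, so the vector
   usually written (hess h x) d is d *m hess h x. *)
Definition hess {R : realType} {n : nat} (h : 'rV[R]_n -> \bar R)
    (x : 'rV[R]_n) : 'M[R]_n := 'J (grad h) x.

Definition hess_form {R : realType} {n : nat} (h : 'rV[R]_n -> \bar R)
    (x d : 'rV[R]_n) : R := dot (d *m hess h x) d.

(* C^1 and C^2 on an open set D (in particular, finite on D). *)
Definition C1_on {R : realType} {n : nat} (D : set 'rV[R]_n)
    (h : 'rV[R]_n -> \bar R) : Prop :=
  forall x, D x ->
    [/\ h x \is a fin_num,
        differentiable (fun y => fine (h y)) x &
        {for x, continuous (grad h)}].

Definition C2_on {R : realType} {n : nat} (D : set 'rV[R]_n)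
    (h : 'rV[R]_n -> \bar R) : Prop :=
  C1_on D h /\
  forall x, D x ->
    differentiable (grad h) x /\ {for x, continuous (hess h)}.

Definition edom {R : realType} {n : nat} (h : 'rV[R]_n -> \bar R) :
  set 'rV[R]_n := [set x | (h x < +oo)%E].

(* Properness includes that h takes its values in (-oo, +oo]. *)
Definition proper_fun {R : realType} {n : nat} (h : 'rV[R]_n -> \bar R) : Prop :=
  (forall x, (-oo < h x)%E) /\ edom h !=set0.

Definition convex_on {R : realType} {n : nat} (D : set 'rV[R]_n)
    (h : 'rV[R]_n -> \bar R) : Prop :=
  forall (x y : 'rV[R]_n) (t : R), D x -> D y -> 0 < t < 1 ->
    (h (t *: x + (1 - t) *: y)%R <= t%:E * h x + (1 - t)%:E * h y)%E.

Definition strongly_convex_on {R : realType} {n : nat} (sigma : R)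
    (D : set 'rV[R]_n) (h : 'rV[R]_n -> \bar R) : Prop :=
  forall (x y : 'rV[R]_n) (t : R), D x -> D y -> 0 < t < 1 ->
    (h (t *: x + (1 - t) *: y)%R
      + (sigma / 2 * (t * (1 - t)) * enorm (x - y) ^+ 2)%:E
     <= t%:E * h x + (1 - t)%:E * h y)%E.

Definition supercoercive {R : realType} {n : nat}
    (F : 'rV[R]_n -> \bar R) : Prop :=
  forall M : R, exists r : R, forall u, r < enorm u ->
    (M%:E <= F u * ((enorm u)^-1)%:E)%E.

Definition argmin {T : Type} {R : realType} (D : set T) (F : T -> \bar R) :
  set T := [set u | D u /\ forall v, D v -> (F u <= F v)%E].

Definition lipschitz_on_bounded {R : realType} {n : nat}
    (F : 'rV[R]_n -> 'rV[R]_n) : Prop :=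
  forall B : set 'rV[R]_n, bounded_set B ->
    exists K : R, forall x y, B x -> B y ->
      enorm (F x - F y) <= K * enorm (x - y).

Definition level_bounded {R : realType} {n : nat}
    (h : 'rV[R]_n -> \bar R) : Prop :=
  forall r : R, bounded_set [set x | (h x <= r%:E)%E].

Definition regular_subdiff {R : realType} {n : nat}
    (h : 'rV[R]_n -> \bar R) (x : 'rV[R]_n) : set 'rV[R]_n :=
  [set xi | edom h x /\
    (0 <= limf_einf (fun y => (h y - h x - (dot xi (y - x))%:E)
                               * ((enorm (x - y))^-1)%:E) x^')%E].

Definition limiting_subdiff {R : realType} {n : nat}
    (h : 'rV[R]_n -> \bar R) (x : 'rV[R]_n) : set 'rV[R]_n :=
  [set xi | exists (y : nat -> 'rV[R]_n) (zeta : nat -> 'rV[R]_n),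
    [/\ forall k, regular_subdiff h (y k) (zeta k),
        y @ \oo --> x,
        h \o y @ \oo --> h x &
        zeta @ \oo --> xi]].

Definition dom_subdiff {R : realType} {n : nat} (h : 'rV[R]_n -> \bar R) :
  set 'rV[R]_n := [set x | limiting_subdiff h x !=set0].

(* Equal to +oo when S is empty. *)
Definition dist_to {R : realType} {n : nat} (x : 'rV[R]_n)
    (S : set 'rV[R]_n) : \bar R :=
  ereal_inf [set (enorm (x - y))%:E | y in S].

(* A function on [0, eps) is represented by a total psi : R -> R; only its
   values on [0, eps) are constrained. *)
Definition desingularizing {R : realType} (eps : \bar R) (psi : R -> R) : Prop :=
  let I := [set s : R | 0 <= s /\ (s%:E < eps)%E] in
  [/\ {within I, continuous psi},
      forall a b t : R, I a -> I b -> 0 < t < 1 ->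
        t * psi a + (1 - t) * psi b <= psi (t * a + (1 - t) * b),
      forall s, I s -> 0 <= psi s,
      forall s : R, 0 < s -> (s%:E < eps)%E ->
        [/\ derivable psi s 1, {for s, continuous (derive1 psi)} & 0 < derive1 psi s] &
      psi 0 = 0].

Definition KL_at {R : realType} {n : nat} (h : 'rV[R]_n -> \bar R)
    (xh : 'rV[R]_n) : Prop :=
  exists (eps : \bar R) (U : set 'rV[R]_n) (psi : R -> R),
    [/\ (0 < eps)%E, nbhs xh U, desingularizing eps psi &
        forall x, U x -> (h xh < h x)%E -> (h x < h xh + eps)%E ->
          (1 <= (derive1 psi (fine (h x - h xh)))%:E
                * dist_to 0%R (limiting_subdiff h x))%E].

Definition KL_function {R : realType} {n : nat}
    (h : 'rV[R]_n -> \bar R) : Prop :=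
  forall x, dom_subdiff h x -> KL_at h x.

Record kernel_generating {R : realType} {n : nat} (C : set 'rV[R]_n)
    (phi : 'rV[R]_n -> \bar R) : Prop := KernelGenerating {
  kg_proper : proper_fun phi;
  kg_lsc : lower_semicontinuous phi;
  kg_convex : convex_on setT phi;
  kg_dom : edom phi `<=` closure C;
  kg_dom_subdiff : dom_subdiff phi = C;
  kg_int_dom : interior (edom phi) = C;
  kg_C1 : C1_on C phi }.

Definition smad {R : realType} {n : nat} (L : R) (C : set 'rV[R]_n)
    (f phi : 'rV[R]_n -> \bar R) : Prop :=
  convex_on C (fun x => L%:E * phi x - f x)%E /\
  convex_on C (fun x => L%:E * phi x + f x)%E.

Definition Psi {R : realType} {n : nat} (f g : 'rV[R]_n -> \bar R)
    (x : 'rV[R]_n) : \bar R := (f x + g x)%E.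

Record assumption_A {R : realType} {n : nat} (C : set 'rV[R]_n)
    (f g phi : 'rV[R]_n -> \bar R) : Prop := AssumptionA {
  A_kernel : kernel_generating C phi;
  A_closure : closure C = closure (edom phi);
  A_C2 : C2_on C phi;
  A_f_proper : proper_fun f;
  A_f_lsc : lower_semicontinuous f;
  A_f_dom : edom phi `<=` edom f;
  A_f_C1 : C1_on C f;
  A_g_proper : proper_fun g;
  A_g_convex : convex_on setT g;
  A_g_dom : (edom g `&` C) !=set0;
  A_inf : (-oo < ereal_inf [set Psi f g x | x in closure C])%E;
  A_supercoercive : forall (x : 'rV[R]_n) (lambda : R),
    interior (edom phi) x -> 0 < lambda ->
    supercoercive
      (fun u => lambda%:E * g u + (2^-1 * hess_form phi x (u - x))%:E)%E }.

Definition subproblem_map {R : realType} {n : nat} (C : set 'rV[R]_n)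
    (f g phi : 'rV[R]_n -> \bar R) (lambda : R) (x : 'rV[R]_n) :
    set 'rV[R]_n :=
  argmin (closure C)
    (fun u => (dot (grad f x) (u - x))%:E + g u
              + ((2 * lambda)^-1 * hess_form phi x (u - x))%:E)%E.

Definition assumption_B {R : realType} {n : nat} (C : set 'rV[R]_n)
    (f g phi : 'rV[R]_n -> \bar R) : Prop :=
  forall (x : 'rV[R]_n) (lambda : R), C x -> 0 < lambda ->
    subproblem_map C f g phi lambda x `<=` C.

Definition assumption_C {R : realType} {n : nat} (C : set 'rV[R]_n)
    (f phi : 'rV[R]_n -> \bar R) : Prop :=
  exists2 L : R, 0 < L & smad L C f phi.

Definition assumption_D {R : realType} {n : nat} (C : set 'rV[R]_n)
    (phi : 'rV[R]_n -> \bar R) : Prop :=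
  exists2 sigma : R, 0 < sigma & strongly_convex_on sigma C phi.

Definition assumption_E {R : realType} {n : nat}
    (f g phi : 'rV[R]_n -> \bar R) : Prop :=
  [/\ lipschitz_on_bounded (grad f), lipschitz_on_bounded (grad phi) &
      level_bounded (Psi f g)].

Definition search_direction {R : realType} {n : nat} (C : set 'rV[R]_n)
    (f g phi : 'rV[R]_n -> \bar R) (lambda : R) (x : 'rV[R]_n) :
    set 'rV[R]_n :=
  argmin [set d | closure C (x + d)]
    (fun d => (dot (grad f x) d)%:E + g (x + d)%R
              + ((2 * lambda)^-1 * hess_form phi x d)%:E)%E.

(* The condition of the while loop: the step size t is rejected. *)
Definition rejected {R : realType} {n : nat}
    (f g : 'rV[R]_n -> \bar R) (alpha : R) (x d : 'rV[R]_n) (t : R) : Prop :=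
  (Psi f g x + (alpha * t)%:E * ((dot (grad f x) d)%:E + g (x + d)%R - g x)
   < Psi f g (x + t *: d)%R)%E.

(* The step size obtained by backtracking from 1 is eta ^+ j, where j is the
   number of rejected trials. *)
Definition abpg_step {R : realType} {n : nat} (C : set 'rV[R]_n)
    (f g phi : 'rV[R]_n -> \bar R) (eta alpha lambda : R)
    (x x' : 'rV[R]_n) : Prop :=
  exists (d : 'rV[R]_n) (j : nat),
    [/\ search_direction C f g phi lambda x d,
        forall i, (i < j)%N -> rejected f g alpha x d (eta ^+ i),
        ~ rejected f g alpha x d (eta ^+ j) &
        x' = x + eta ^+ j *: d].

Definition abpg_sequence {R : realType} {n : nat} (C : set 'rV[R]_n)
    (f g phi : 'rV[R]_n -> \bar R) (eta alpha lambda : R)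
    (x : nat -> 'rV[R]_n) : Prop :=
  interior (edom phi) (x 0) /\
  forall k, abpg_step C f g phi eta alpha lambda (x k) (x k.+1).

(* Main.v *)
(* With g = 0, optimality of d^k says that grad f(x^k) is the image of d^k under
   -1/lambda times the symmetrized Hessian of phi. The Hessian form is bounded
   below by strong convexity, and above, on the bounded level set that contains
   the iterates, by the Lipschitz continuity of grad phi. Backtracking stops at a
   step size bounded away from 0. Hence, for some a, b > 0,
     f(x^k) - f(x^{k+1}) >= a |x^{k+1} - x^k|^2  and
     |grad f(x^k)| <= b |x^{k+1} - x^k|.
   Near a cluster point the KL inequality and the concavity of psi turn these
   into (a/b) |x^{k+1} - x^k| <= psi(D_k) - psi(D_{k+1}), where D_k is the
   optimality gap: the right-hand side telescopes, which traps the iterates near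
   the cluster point and bounds the length of the sequence. *)
Require Import Defs.
From HB Require Import structures.
From mathcomp Require Import all_boot all_order all_algebra.
From mathcomp Require Import all_classical all_reals all_analysis.
From mathcomp Require Import ring lra.
Import Order.TTheory GRing.Theory Num.Theory.
Import numFieldNormedType.Exports.
Local Open Scope classical_set_scope.
Local Open Scope ring_scope.

Set Implicit Arguments.
Unset Strict Implicit.
Unset Printing Implicit Defensive.

(** * Euclidean inner product and norm, compared with the sup norm *)

Section euclidean.
Context {R : realType} {n : nat}.
Implicit Types (u v w : 'rV[R]_n) (a : R).

Lemma dotC u v : dot u v = dot v u.
Proof. by apply: eq_bigr => i _; rewrite mulrC. Qed.

Lemma dotDl u v w : dot (u + v) w = dot u w + dot v w.
Proof. by rewrite -big_split; apply: eq_bigr => i _; rewrite mxE mulrDl. Qed.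

Lemma dotDr u v w : dot w (u + v) = dot w u + dot w v.
Proof. by rewrite dotC dotDl !(dotC w). Qed.

Lemma dotZl a u v : dot (a *: u) v = a * dot u v.
Proof. by rewrite mulr_sumr; apply: eq_bigr => i _; rewrite mxE mulrA. Qed.

Lemma dotZr a u v : dot u (a *: v) = a * dot u v.
Proof. by rewrite dotC dotZl dotC. Qed.

Lemma dotNl u v : dot (- u) v = - dot u v.
Proof. by rewrite -scaleN1r dotZl mulN1r. Qed.

Lemma dotNr u v : dot u (- v) = - dot u v.
Proof. by rewrite dotC dotNl dotC. Qed.

Lemma dotuu_ge0 u : 0 <= dot u u.
Proof. by apply: sumr_ge0 => i _; rewrite -expr2 sqr_ge0. Qed.

Lemma enorm_ge0 u : 0 <= enorm u.
Proof. exact: sqrtr_ge0. Qed.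

Lemma sqr_enorm u : enorm u ^+ 2 = dot u u.
Proof. by rewrite sqr_sqrtr // dotuu_ge0. Qed.

Lemma normr_le_enorm u : `|u| <= enorm u.
Proof.
rewrite [leLHS]/Num.norm /= mx_normrE; apply/bigmax_leP; split => [|[i j] _ /=].
  exact: enorm_ge0.
rewrite ord1 -sqrtr_sqr; apply: ler_wsqrtr.
rewrite /dot (bigD1 j) //= -expr2 lerDl.
by apply: sumr_ge0 => k _; rewrite -expr2 sqr_ge0.
Qed.

Lemma enorm_le_normr u : enorm u <= Num.sqrt n%:R * `|u|.
Proof.
rewrite -[`|u|]normr_id -sqrtr_sqr -sqrtrM ?ler0n //; apply: ler_wsqrtr.
rewrite mulr_natl -[X in _ *+ X]card_ord -sumr_const; apply: ler_sum => i _.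
rewrite -expr2 -real_normK ?num_real // ler_pXn2r ?nnegrE //.
rewrite [leRHS]/Num.norm /= mx_normrE.
exact: (@le_bigmax _ _ _ _ (fun ij : 'I_1 * 'I_n => `|u ij.1 ij.2|) (ord0, i)).
Qed.

Lemma enorm0 : enorm (0 : 'rV[R]_n) = 0.
Proof. by apply/eqP; rewrite eq_le enorm_ge0 (le_trans (enorm_le_normr _)) // normr0 mulr0. Qed.

Lemma enorm0_eq0 u : enorm u = 0 -> u = 0.
Proof.
by move=> u0; apply/eqP; rewrite -normr_eq0 eq_le normr_ge0 andbT -u0 normr_le_enorm.
Qed.

(** Cauchy-Schwarz: for nonzero norms, expand the square of |v| u - |u| v. *)
Lemma dot_le_enorm u v : dot u v <= enorm u * enorm v.
Proof.
have [/enorm0_eq0 ->|u0] := eqVneq (enorm u) 0.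
  by rewrite -(scale0r (0 : 'rV[R]_n)) dotZl mul0r mulr_ge0 ?enorm_ge0.
have [/enorm0_eq0 ->|v0] := eqVneq (enorm v) 0.
  by rewrite -(scale0r (0 : 'rV[R]_n)) dotZr mul0r mulr_ge0 ?enorm_ge0.
have uv0 : 0 < enorm u * enorm v.
  by rewrite mulr_gt0 // lt_neqAle eq_sym ?u0 ?v0 enorm_ge0.
rewrite -(ler_pM2l uv0) -subr_ge0.
have := dotuu_ge0 (enorm v *: u - enorm u *: v).
rewrite !(dotDl, dotDr, dotNl, dotNr, dotZl, dotZr) -!sqr_enorm (dotC v u).
lra.
Qed.

Lemma enormZ a u : enorm (a *: u) = `|a| * enorm u.
Proof.
by rewrite /enorm dotZl dotZr mulrA -expr2 sqrtrM ?sqr_ge0 // sqrtr_sqr.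
Qed.

Lemma enormN u : enorm (- u) = enorm u.
Proof. by rewrite -scaleN1r enormZ normrN1 mul1r. Qed.

Lemma enormB u v : enorm (u - v) = enorm (v - u).
Proof. by rewrite -enormN opprB. Qed.

Lemma enormD u v : enorm (u + v) <= enorm u + enorm v.
Proof.
rewrite -(@ler_pXn2r _ 2%N) ?nnegrE ?addr_ge0 ?enorm_ge0 //.
rewrite sqr_enorm !(dotDl, dotDr) sqrrD !sqr_enorm (dotC v u).
have := dot_le_enorm u v; lra.
Qed.

Lemma continuous_dotr w : continuous (fun u => dot u w).
Proof.
apply: continuous_big => [|i _]; first exact: add_continuous.
by move=> u; apply: continuousM; [exact: coord_continuous|exact: cst_continuous].
Qed.

Lemma continuous_enorm : continuous (@enorm R n).
Proof.
have dotuu : continuous (fun u : 'rV[R]_n => dot u u).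
  apply: continuous_big => [|i _ u]; first exact: add_continuous.
  by apply: continuousM; exact: coord_continuous.
by move=> u; apply: continuous_comp; [exact: dotuu|exact: sqrt_continuous].
Qed.

(** The topology comes from the sup norm; with [near_enorm], this lets neighbourhoods be handled
    through Euclidean balls. *)
Lemma nbhs_enorm (A : set 'rV[R]_n) u :
  nbhs u A -> exists2 r, 0 < r & forall v, enorm (v - u) < r -> A v.
Proof.
move=> /nbhs_ballP[r /= r0 rA]; exists r => // v uv; apply: rA.
by rewrite -ball_normE /ball_ /= distrC (le_lt_trans (normr_le_enorm _)).
Qed.

Lemma near_enorm u (r : R) : 0 < r -> \forall v \near u, enorm (v - u) < r.
Proof.
move=> r0; have s0 : 0 < Num.sqrt n%:R + 1 :> R by rewrite ltr_wpDl ?sqrtr_ge0.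
apply/nbhs_ballP; exists (r / (Num.sqrt n%:R + 1)); first exact: divr_gt0.
move=> v; rewrite -ball_normE /ball_ /= distrC ltr_pdivlMr // => uv.
apply: le_lt_trans (enorm_le_normr _) (le_lt_trans _ uv).
by rewrite mulrC ler_wpM2l // lerDl.
Qed.

End euclidean.

(** * Derivatives along lines and subgradients of differentiable functions *)

Section differentiation.
Context {R : realType} {n : nat}.
Implicit Types (x d v : 'rV[R]_n).

Lemma is_derive_line (V W : normedModType R) (h : V -> W) (x d : V) (s : R) :
  differentiable h (x + s *: d) ->
  is_derive s 1 (fun t => h (x + t *: d)) ('D_d h (x + s *: d)).
Proof.
move=> dh.
have E : (fun k : R => k^-1 *:
    (((fun t => h (x + t *: d)) \o shift s) (k *: 1) - h (x + s *: d))) =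
  (fun k => k^-1 *: ((h \o shift (x + s *: d)) (k *: d) - h (x + s *: d))).
  apply/funext => k /=; congr (_ *: (h _ - _)).
  by rewrite [k *: 1]mulr1 scalerDl addrCA.
split; rewrite /derivable /derive E //; exact: diff_derivable.
Qed.

Lemma dot_grad (h : 'rV[R]_n -> \bar R) x v :
  differentiable (fine \o h) x -> dot (grad h x) v = 'D_v (fine \o h) x.
Proof.
move=> dh; rewrite deriveE // [in RHS](row_sum_delta v) linear_sum.
by apply: eq_bigr => i _; rewrite linearZ /= mxE deriveE // mulrC.
Qed.

(** Passes to the limit from the right only, because the convexity and monotonicity inequalities
    below hold for small t > 0. Upper bounds on a derivative come from applying it to the opposite
    function. *)
Lemma derive_ge (h : R -> R) (l c : R) :
  is_derive (0 : R) (1 : R) h l -> (\forall t \near (0 : R)^'+, t * c <= h t - h 0) -> c <= l.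
Proof.
move=> [dh <-] hc.
have hl : (fun t : R => t^-1 *: ((h \o shift 0) (t *: 1) - h 0)) @ (0 : R)^'+ -->
    'D_1 h 0.
  exact: cvg_dnbhs_at_right.
apply: (cvgr_to_ge hl); near=> t.
rewrite /= addr0 [t *: 1]mulr1 [leRHS]mulrC ler_pdivlMr //.
by rewrite mulrC; near: t.
Unshelve. all: by end_near. Qed.

Lemma grad_regular_subdiff (h : 'rV[R]_n -> \bar R) x :
  (forall y, h y \is a fin_num) -> differentiable (fine \o h) x ->
  regular_subdiff h x (grad h x).
Proof.
move=> hfin dh; split; first by rewrite /edom /= ltey_eq hfin.
rewrite limf_einfE; apply/lee_addgt0Pr => e e0.
move: (dh) => /diff_locallyP[_ /eqaddoP/(_ _ e0)] /nbhs_ballP[r /= r0 rh].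
(* On this punctured ball the first-order remainder is at most e |y - x|, so the quotients are at
   least -e; V then witnesses the supremum that defines the lower limit. *)
set V := [set y | y != x /\ ball x r y].
have VF : x^' V.
  rewrite /V; near=> y; split; near: y; first exact: nbhs_dnbhs_neq.
  by apply: nbhs_dnbhs; exact: nbhsx_ballx.
rewrite -leeBlDr // sub0e; apply: le_trans; last first.
  by apply: ereal_sup_ubound; exists V => //; reflexivity.
apply: le_ereal_inf_tmp => _ [y [yx xry] <-].
have := rh (y - x); rewrite -ball_normE /ball_ /= sub0r normrN.
move: xry; rewrite -ball_normE /ball_ /= distrC => xry /(_ xry).
rewrite /cst !fctE /= subrK -deriveE // -dot_grad // => hyx.
rewrite -(fineK (hfin x)) -(fineK (hfin y)) -!EFinB -EFinM lee_fin.
rewrite ler_pdivlMr; last first.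
  by rewrite (lt_le_trans _ (normr_le_enorm _)) // normr_gt0 subr_eq0 eq_sym.
move: hyx; rewrite ler_norml => /andP[+ _].
have := normr_le_enorm (x - y); rewrite distrC -(ler_pM2l e0).
lra.
Unshelve. all: by end_near. Qed.

(** Membership bounds the distance from 0 to the subdifferential above by the norm of the gradient,
    the direction used both in the KL inequality and in the limit of the distances. *)
Lemma grad_limiting_subdiff (h : 'rV[R]_n -> \bar R) x :
  (forall y, h y \is a fin_num) -> differentiable (fine \o h) x ->
  limiting_subdiff h x (grad h x).
Proof.
move=> hfin dh; exists (cst x), (cst (grad h x)); split.
- by move=> k; exact: grad_regular_subdiff.
- exact: cvg_cst.
- exact: (cvg_cst (h x)).
- exact: cvg_cst.
Qed.

Lemma dist_to_ge0 x (S : set 'rV[R]_n) : (0 <= dist_to x S)%E.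
Proof. by apply: le_ereal_inf_tmp => _ [y _ <-]; rewrite lee_fin enorm_ge0. Qed.

Lemma dist_to_le x y (S : set 'rV[R]_n) :
  S y -> (dist_to x S <= (enorm (x - y))%:E)%E.
Proof. by move=> Sy; apply: ereal_inf_lbound; exists y. Qed.

End differentiation.

(** * Tangent inequalities, Hessian bounds and stationarity of quadratics *)

Section calculus.
Context {R : realType} {n : nat}.
Implicit Types (x y d v w : 'rV[R]_n) (h : 'rV[R]_n -> \bar R).

Lemma is_derive_dot (p : R -> 'rV[R]_n) (s : R) (dp w : 'rV[R]_n) :
  is_derive s 1 p dp -> is_derive s 1 (fun t => dot (p t) w) (dot dp w).
Proof.
move=> [dpS <-].
set q := fun k : R => k^-1 *: ((p \o shift s) (k *: 1) - p s).
have E : (fun k : R => k^-1 *: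
    (((fun t => dot (p t) w) \o shift s) (k *: 1) - dot (p s) w)) =
  (fun u => dot u w) \o q.
  by apply/funext => k /=; rewrite /q dotZl dotDl dotNl.
have H : (fun u => dot u w) \o q @ 0^' --> dot ('D_1 p s) w.
  by apply: cvg_comp; [exact: dpS|exact: continuous_dotr].
by split; rewrite /derivable /derive E; [exact: cvgP H|exact: cvg_lim H].
Qed.

Lemma mean_value_grad h x v : (forall y, differentiable (fine \o h) y) ->
  exists2 c, 0 < c < 1 &
    fine (h (x + v)) - fine (h x) = dot (grad h (x + c *: v)) v.
Proof.
move=> dh.
have dpath (s : R) : is_derive s 1 (fun t => fine (h (x + t *: v)))
    (dot (grad h (x + s *: v)) v).
  by rewrite dot_grad //; exact: (is_derive_line (h := fine \o h)).
have [|c + E] := MVT ltr01 (fun s _ => dpath s).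
  apply: continuous_subspaceT => s; apply: differentiable_continuous.
  by apply/derivable1_diffP; case: (dpath s).
rewrite in_itv /= => c01; exists c => //.
by move: E; rewrite subr0 mulr1 scale1r scale0r addr0.
Qed.

(** Differentiability is asked at a only: b will be the next optimality gap, which may be the
    endpoint 0, where a desingularizing function need have no derivative. *)
Lemma concave_tangent (I : set R) (psi : R -> R) (a b : R) :
  (forall a b t : R, I a -> I b -> 0 < t < 1 ->
    t * psi a + (1 - t) * psi b <= psi (t * a + (1 - t) * b)) ->
  I a -> I b -> derivable psi a 1 ->
  derive1 psi a * (a - b) <= psi a - psi b.
Proof.
move=> conc Ia Ib dpsi.
have dpsiE : 'D_(b - a) psi a = (b - a) * derive1 psi a.
  have dfa : differentiable psi a by apply/derivable1_diffP.
  by rewrite derive1E !deriveE // -[X in 'd _ _ X]mulr1 linearZ.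
have dpath : is_derive (0 : R) (1 : R) (fun t => psi (a + t *: (b - a)))
    ((b - a) * derive1 psi a).
  have := @is_derive_line _ _ _ psi a (b - a) 0.
  by rewrite scale0r addr0 -dpsiE; apply; exact/derivable1_diffP.
suff : psi b - psi a <= (b - a) * derive1 psi a by lra.
apply: (derive_ge dpath); near=> t.
have t01 : 0 < t < 1.
  by apply/andP; split; near: t; [exact: nbhs_right_gt|exact: nbhs_right_lt].
have := conc b a t Ib Ia t01; rewrite scale0r addr0.
have -> : t * b + (1 - t) * a = a + t *: (b - a).
  by rewrite -[_ *: _]/(t * _); ring.
lra.
Unshelve. all: by end_near. Qed.

(* The constant sigma / 4 instead of sigma / 2 comes from the bound 1 - t >= 1/2
   in the definition of strong convexity, which avoids a limit. *)
Lemma strongly_convex_tangent sigma h x y : 0 < sigma ->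
  strongly_convex_on sigma setT h -> (forall y, h y \is a fin_num) ->
  differentiable (fine \o h) x ->
  fine (h x) + dot (grad h x) (y - x) + sigma / 4 * enorm (y - x) ^+ 2
    <= fine (h y).
Proof.
move=> sigma0 sc hfin dh.
have dpath : is_derive (0 : R) (1 : R) (fun t => - fine (h (x + t *: (y - x))))
    (- dot (grad h x) (y - x)).
  have := is_derive_line (h := fine \o h) (x := x) (d := y - x) (s := 0).
  rewrite scale0r addr0 -dot_grad // => /(_ dh) hpath.
  exact: is_deriveN.
suff : fine (h x) - fine (h y) + sigma / 4 * enorm (y - x) ^+ 2 <=
  - dot (grad h x) (y - x) by lra.
apply: (derive_ge dpath); near=> t.
have t0 : 0 < t by near: t; exact: nbhs_right_gt.
have t1 : t < 2^-1 by near: t; apply: nbhs_right_lt; rewrite invr_gt0.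
have t01 : 0 < t < 1 by apply/andP; split; lra.
have := sc y x t I I t01; rewrite scale0r addr0.
have -> : t *: y + (1 - t) *: x = x + t *: (y - x).
  by rewrite scalerBl scale1r scalerBr addrCA.
rewrite -(fineK (hfin (x + _))) -(fineK (hfin x)) -(fineK (hfin y)).
rewrite -!EFinM -!EFinD lee_fin.
set e := enorm _ ^+ 2.
have te : 0 <= t * sigma * e * (2^-1 - t).
  by rewrite !mulr_ge0 ?subr_ge0 ?enorm_ge0 // ltW.
rewrite /=; lra.
Unshelve. all: by end_near. Qed.

(** Sum of the tangent inequalities at x and at y. *)
Lemma strongly_convex_monotone sigma h x y : 0 < sigma ->
  strongly_convex_on sigma setT h -> (forall y, h y \is a fin_num) ->
  (forall y, differentiable (fine \o h) y) ->
  sigma / 2 * enorm (y - x) ^+ 2 <= dot (grad h y - grad h x) (y - x).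
Proof.
move=> sigma0 sc hfin dh.
have := strongly_convex_tangent y sigma0 sc hfin (dh x).
have := strongly_convex_tangent x sigma0 sc hfin (dh y).
rewrite (enormB x y) -(opprB y x) dotNr dotDl dotNl; lra.
Qed.

Lemma is_derive_grad_line h x d w : differentiable (grad h) x ->
  is_derive (0 : R) (1 : R) (fun t => dot (grad h (x + t *: d)) w)
    (dot (d *m hess h x) w).
Proof.
move=> dg; have -> : d *m hess h x = 'D_d (grad h) x.
  by rewrite (deriveEjacobian d dg).
have := is_derive_line (h := grad h) (x := x) (d := d) (s := 0).
rewrite scale0r addr0 => /(_ dg); exact: is_derive_dot.
Qed.

(** The Hessian form is the derivative at 0 of t |-> <grad h(x + t d), d>, whose increments are
    bounded below by strong monotonicity. *)
Lemma hess_form_ge sigma h x d : 0 < sigma ->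
  strongly_convex_on sigma setT h -> (forall y, h y \is a fin_num) ->
  (forall y, differentiable (fine \o h) y) -> differentiable (grad h) x ->
  sigma / 2 * enorm d ^+ 2 <= hess_form h x d.
Proof.
move=> sigma0 sc hfin dh dg.
apply: (derive_ge (is_derive_grad_line d d dg)); near=> t.
have t0 : 0 < t by near: t; exact: nbhs_right_gt.
have := strongly_convex_monotone x (x + t *: d) sigma0 sc hfin dh.
rewrite scale0r addr0 [x + _ - x]addrC addKr enormZ gtr0_norm // dotZr.
rewrite dotDl dotNl => mono; rewrite -(ler_pM2l t0); lra.
Unshelve. all: by end_near. Qed.

(** The strict bound on [|x|] keeps x + t d in the ball for small t > 0, where the Lipschitz bound
    controls the difference quotients of the gradient. *)
Lemma hess_le (K r : R) h x d w : differentiable (grad h) x -> `|x| < r ->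
  (forall y z, `|y| <= r -> `|z| <= r ->
    enorm (grad h y - grad h z) <= K * enorm (y - z)) ->
  dot (d *m hess h x) w <= K * (enorm d * enorm w).
Proof.
move=> dg xr lip; rewrite -lerN2.
have dgN : is_derive (0 : R) (1 : R) (fun t => - dot (grad h (x + t *: d)) w)
    (- dot (d *m hess h x) w).
  exact: is_deriveN (is_derive_grad_line d w dg).
have step : \forall t \near (0 : R)^'+, t * `|d| <= r - `|x|.
  have [->|d0] := eqVneq d 0.
    by near=> t; rewrite normr0 mulr0 subr_ge0 ltW.
  near=> t; rewrite -ler_pdivlMr ?normr_gt0 //; near: t; apply: nbhs_right_le.
  by rewrite divr_gt0 ?subr_gt0 ?normr_gt0.
apply: (derive_ge dgN); near=> t.
have t0 : 0 < t by near: t; exact: nbhs_right_gt.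
rewrite scale0r addr0.
have xtr : `|x + t *: d| <= r.
  rewrite (le_trans (ler_normD _ _)) // normrZ gtr0_norm // -lerBrDl.
  by near: t.
have := dot_le_enorm (grad h (x + t *: d) - grad h x) w.
have := lip _ _ xtr (ltW xr).
rewrite [x + _ - x]addrC addKr enormZ gtr0_norm // dotDl dotNl.
move=> /(ler_wpM2r (enorm_ge0 w)); lra.
Unshelve. all: by end_near. Qed.

Lemma quadratic_ge0 (p q : R) : (forall s, 0 <= s * p + s ^+ 2 * q) -> p = 0.
Proof.
move=> pq; apply/eqP; rewrite -sqrf_eq0 eq_le sqr_ge0 andbT.
have q1 : 0 < 1 + `|q| by rewrite ltr_wpDr.
(* The denominator 1 + |q| exceeds q and is positive, so this choice makes the value a negative
   multiple of p^2 whatever the sign of q. *)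
have := pq (- p / (1 + `|q|)).
have -> : - p / (1 + `|q|) * p + (- p / (1 + `|q|)) ^+ 2 * q =
   - (p ^+ 2 * (1 + `|q| - q)) / (1 + `|q|) ^+ 2 by field; rewrite gt_eqF.
rewrite pmulr_lge0 ?invr_gt0 ?exprn_gt0 // oppr_ge0 pmulr_lle0 //.
by have := ler_norm q; lra.
Qed.

(** Perturbing d to d + s v leaves a linear plus a quadratic term in s, nonnegative for all s, so
    the linear coefficient vanishes. *)
Lemma quadratic_stationary (A : 'M[R]_n) (b d : 'rV[R]_n) (k : R) :
  (forall v, dot b d + k * dot (d *m A) d <= dot b v + k * dot (v *m A) v) ->
  forall v, dot b v = - (k * (dot (d *m A) v + dot (v *m A) d)).
Proof.
move=> dmin v; apply/eqP; rewrite -subr_eq0 opprK; apply/eqP.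
apply: (@quadratic_ge0 _ (k * dot (v *m A) v)) => s.
have := dmin (d + s *: v).
rewrite mulmxDl -scalemxAl !(dotDl, dotDr, dotZl, dotZr); lra.
Qed.

End calculus.

(* Joins the library's complete and normed structures on matrices. *)
HB.instance Definition _ (R : realType) m n :=
  Complete.copy 'M[R]_(m, n) 'M[R]_(m, n).

(** * Finite length of gradient-like descent sequences under the KL property *)

Section finite_length.
Context {R : realType} {n : nat}.
Variables (h : 'rV[R]_n -> \bar R) (x : nat -> 'rV[R]_n) (a b : R).
Hypotheses (a0 : 0 < a) (b0 : 0 < b).
Hypothesis hfin : forall y, h y \is a fin_num.
Hypothesis dh : forall y, differentiable (fine \o h) y.
Hypothesis grad_cont : continuous (grad h).
Hypothesis x_bounded : bounded_set (range x).
Hypothesis decrease : forall k,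
  a * enorm (x k.+1 - x k) ^+ 2 <= fine (h (x k)) - fine (h (x k.+1)).
Hypothesis grad_le_step : forall k,
  enorm (grad h (x k)) <= b * enorm (x k.+1 - x k).
Hypothesis hKL : KL_function h.

Let H y := fine (h y).
Let step k := enorm (x k.+1 - x k).

Let H_nonincreasing i j : (i <= j)%N -> H (x j) <= H (x i).
Proof.
move: i j; apply/nonincreasing_seqP => k.
by rewrite -subr_ge0 (le_trans _ (decrease k)) // mulr_ge0 ?sqr_ge0 // ltW.
Qed.

Let seq_cluster : exists xt, cluster (x @ \oo) xt.
Proof.
have [M [_ xM]] := x_bounded.
have : compact [set y : 'rV[R]_n | `|y| <= M + 1].
  apply: bounded_closed_compact.
    by exists (M + 1); split; rewrite ?num_real // => K MK y /= /le_trans-> //; exact: ltW.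
  rewrite (_ : mkset _ = (fun y => `|y|) @^-1` [set r : R | r <= M + 1]) //.
  by apply: closed_comp; [move=> y _; exact: norm_continuous|exact: closed_le].
move=> /(_ (x @ \oo) _)[].
  by exists 0%N => // k _; apply: (xM (M + 1)); [rewrite ltrDl|exists k].
by move=> xt [_ clxt]; exists xt.
Qed.

(** If h(xt) exceeded h(x_k), continuity would force a later iterate above h(x_k), against
    monotonicity. *)
Let limit_point_le xt k : cluster (x @ \oo) xt -> H xt <= H (x k).
Proof.
move=> clxt; rewrite leNgt; apply/negP => Hk.
have nbhsH : nbhs xt [set y | H (x k) < H y].
  have := differentiable_continuous (dh xt).
  by move=> /cvgr_gt/(_ _ Hk).
have tail : (x @ \oo) [set x j | j in [set j | (k <= j)%N]].
  by exists k => // j /= kj; exists j.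
have [_ [[j /= kj <-]]] := clxt _ _ tail nbhsH.
by rewrite /= ltNge H_nonincreasing.
Qed.

Let length_bounded :
  exists M, forall N, \sum_(0 <= k < N) step k <= M.
Proof.
have [xt clxt] := seq_cluster.
have [|eps [U [psi [eps0 Uxt]]]] := hKL (x := xt).
  by exists (grad h xt); exact: grad_limiting_subdiff.
move=> [psi_cont psi_conc psi_ge0 psi_C1 psi0] KL.
set D := fun k => H (x k) - H xt.
have D0 k : 0 <= D k by rewrite subr_ge0 limit_point_le.
have DS k : a * step k ^+ 2 <= D k - D k.+1.
  by rewrite /D /H /step; have := decrease k; lra.
have step0 k : 0 <= step k by exact: enorm_ge0.
pose c := a / b.
have c0 : 0 < c by rewrite divr_gt0.
have DSle k : D k.+1 <= D k by rewrite lerD2r H_nonincreasing.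
have psi_step k : U (x k) -> ((D k)%:E < eps)%E ->
    c * step k <= psi (D k) - psi (D k.+1).
  (* The KL inequality is silent when the gap is 0, but then the next gap is 0 too and the decrease
     condition forces a zero step. *)
  move=> Uk Deps; have [Dk0|Dk0] := eqVneq (D k) 0.
    have DS0 : D k.+1 = 0 by apply/eqP; rewrite eq_le D0 -Dk0 DSle.
    have : a * step k ^+ 2 <= a * 0 by rewrite mulr0 (le_trans (DS k)) // Dk0 DS0 subr0.
    rewrite (ler_pM2l a0) => s2; have -> : step k = 0.
      by apply/eqP; rewrite -sqrf_eq0 eq_le s2 sqr_ge0.
    by rewrite mulr0 Dk0 DS0 subrr.
  have {}Dk0 : 0 < D k by rewrite lt_neqAle eq_sym Dk0 D0.
  have hD : (h (x k) - h xt)%E = (D k)%:E.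
    by rewrite -(fineK (hfin (x k))) -(fineK (hfin xt)).
  have [dpsi _ psi'0] := psi_C1 _ Dk0 Deps.
  have KLk : 1 <= derive1 psi (D k) * enorm (grad h (x k)).
    rewrite -lee_fin EFinM; apply: le_trans (KL _ Uk _ _) _.
    - by rewrite -sube_gt0 hD lte_fin.
    - by rewrite addeC -lteBlDr ?hfin // hD.
    rewrite hD /=; apply: lee_wpmul2l; first by rewrite lee_fin ltW.
    rewrite -enormN -sub0r; apply: dist_to_le.
    exact: grad_limiting_subdiff.
  have ID j : (j = k \/ j = k.+1) -> 0 <= D j /\ ((D j)%:E < eps)%E.
    move=> jk; split => //; apply: le_lt_trans Deps; rewrite lee_fin.
    by case: jk => ->.
  have tan := concave_tangent psi_conc (ID k (or_introl erefl))
    (ID k.+1 (or_intror erefl)) dpsi.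
  (* KL and the gradient bound give 1 <= psi'(D_k) b |step|; multiplying by c |step| turns b into
     a. *)
  apply: le_trans tan; apply: (@le_trans _ _ (derive1 psi (D k) * (a * step k ^+ 2))).
    have : 1 <= derive1 psi (D k) * (b * step k).
      by rewrite (le_trans KLk) // ler_pM2l // grad_le_step.
    have cs0 : 0 <= c * step k by rewrite mulr_ge0 // ltW.
    move=> /(ler_wpM2l cs0); rewrite mulr1 => /le_trans; apply.
    by rewrite /c le_eqVlt; apply/orP; left; apply/eqP; field; rewrite gt_eqF.
  by rewrite ler_pM2l.
have [rho rho0 rhoU] := nbhs_enorm Uxt.
have psi_small : exists2 delta, 0 < delta & forall s, 0 <= s -> s < delta ->
    (s%:E < eps)%E /\ psi s < c * (rho / 2).
  (* [eps] may be infinite, so a positive real below it is chosen first. *)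
  have [e e0 eeps] : exists2 e : R, 0 < e & (e%:E <= eps)%E.
    case: (eps) eps0 => [e e0| _|//]; first by exists e.
    by exists 1 => //; rewrite leey.
  have crho : psi 0 < c * (rho / 2) by rewrite psi0 mulr_gt0 ?divr_gt0.
  have /subspace_continuousP/(_ 0) := psi_cont.
  move=> /(_ (conj (lexx 0) eps0))/cvgr_lt/(_ _ crho).
  move=> /nbhs_ballP[r /= r0 rpsi].
  exists (Num.min r e) => [|s s0]; rewrite lt_min ?r0 // => /andP[sr se].
  have seps : (s%:E < eps)%E by apply: lt_le_trans eeps; rewrite lte_fin.
  split => //; apply: rpsi => //.
  by rewrite /ball /= sub0r normrN ger0_norm.
have [delta delta0 psi_delta] := psi_small.
(* From [k0] on, both the initial distance and the remaining length will stay below rho / 2, so the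
   iterates remain in the ball of radius rho inside [U]. *)
have [k0 [xk0 Dk0]] : exists k0, enorm (x k0 - xt) < rho / 2 /\ D k0 < delta.
  have near1 : nbhs xt [set y | enorm (y - xt) < rho / 2].
    by apply: near_enorm; rewrite divr_gt0.
  have near2 : nbhs xt [set y | H y < H xt + delta].
    have := differentiable_continuous (dh xt).
    by move=> /cvgr_lt; apply; rewrite ltrDl.
  have all : (x @ \oo) (range x) by exists 0%N => // k _; exists k.
  have [_ [[k _ <-] [/= ? ?]]] := clxt _ _ all (filterI near1 near2).
  by exists k; split => //; rewrite /D ltrBlDl.
have [Dk0eps psik0] := psi_delta _ (D0 k0) Dk0.
have D_anti k : D (k0 + k)%N <= D k0.
  by rewrite lerD2r H_nonincreasing // leq_addr.
(* The two bounds need a joint induction: the length bound puts the current iterate in [U], where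
   [psi_step] applies and extends the length bound. *)
have trap k : enorm (x (k0 + k)%N - xt) <=
    enorm (x k0 - xt) + \sum_(0 <= i < k) step (k0 + i)%N /\
    c * \sum_(0 <= i < k) step (k0 + i)%N <= psi (D k0) - psi (D (k0 + k)%N).
  elim: k => [|k [IH1 IH2]].
    by rewrite !big_nil addn0 addr0 mulr0 subrr.
  have Deps : ((D (k0 + k)%N)%:E < eps)%E.
    by apply: le_lt_trans Dk0eps; rewrite lee_fin.
  have psik : 0 <= psi (D (k0 + k)%N) by apply: psi_ge0.
  have Uk : U (x (k0 + k)%N).
    apply: rhoU; apply: le_lt_trans IH1 _.
    have : \sum_(0 <= i < k) step (k0 + i)%N < rho / 2 by rewrite -(ltr_pM2l c0); lra.
    lra.
  have := psi_step _ Uk Deps; rewrite !big_nat_recr //= addnS => psikS; split.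
    rewrite addrA; apply: le_trans (lerD IH1 (lexx _)).
    rewrite [leRHS]addrC /step -[X in enorm X <= _](subrKA (x (k0 + k)%N)).
    exact: enormD.
  by rewrite mulrDr; lra.
exists (\sum_(0 <= i < k0) step i + rho / 2) => N.
have := trap N => -[_ tN].
have Deps : ((D (k0 + N)%N)%:E < eps)%E.
  by apply: le_lt_trans Dk0eps; rewrite lee_fin.
have psiN : 0 <= psi (D (k0 + N)%N) by apply: psi_ge0.
have sN : \sum_(0 <= i < N) step (k0 + i)%N < rho / 2 by rewrite -(ltr_pM2l c0); lra.
apply: (@le_trans _ _ (\sum_(0 <= i < k0 + N) step i)).
  by rewrite [leRHS](big_cat_nat _ (leq_addl _ _)) //= lerDl sumr_ge0.
rewrite (big_cat_nat _ (leq_addr _ _)) //= lerD2l ltW //.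
rewrite -{1}(add0n k0) big_addn addKn; apply: le_lt_trans sN.
by under eq_bigr do rewrite addnC.
Qed.

Lemma finite_length : (\sum_(1 <= k <oo) (enorm (x k - x k.-1))%:E < +oo)%E.
Proof.
have [M HM] := length_bounded.
apply: (@le_lt_trans _ _ M%:E); last exact: ltry.
apply: lime_le => [|]; first by apply: is_cvg_nneseries => k _ _; rewrite lee_fin enorm_ge0.
(* The terms with 1 <= k < N are the first [N.-1] steps, shifted by one. *)
near=> N; rewrite sumEFin lee_fin; apply: le_trans (HM N.-1).
by rewrite big_add1.
Unshelve. all: by end_near. Qed.

(** The increments are absolutely summable, so completeness gives a limit; the gradient vanishes
    there because it is bounded by b times steps that tend to 0. *)
Lemma finite_length_cvg : exists2 xt, x @ \oo --> xt & grad h xt = 0.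
Proof.
have [M HM] := length_bounded.
have : cvgn [normed series (telescope x)].
  apply: nondecreasing_is_cvgn.
    by apply/nondecreasing_seqP => k; rewrite -subr_ge0 seriesSB normr_ge0.
  exists M => _ [N _ <-]; apply: le_trans (HM N).
  by apply: ler_sum => k _; exact: normr_le_enorm.
move=> /normed_cvg; rewrite telescopeK => cvgx.
have [xt xxt] : exists xt : 'rV[R]_n, x @ \oo --> xt.
  exists (limn [sequence x k - x 0%N]_k + x 0%N).
  have xE : [sequence x k - x 0%N]_k + cst (x 0%N) = x.
    by apply/funext => k; rewrite !fctE /= subrK.
  have := cvgD cvgx (cvg_cst (x 0%N)).
  by rewrite xE; apply.
exists xt; first exact: xxt.
apply: enorm0_eq0.
have grad_xt : enorm (grad h (x k)) @[k --> \oo] --> enorm (grad h xt).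
  apply: continuous_cvg; first exact: continuous_enorm.
  by apply: continuous_cvg; [exact: grad_cont|exact: xxt].
have step_xt : b * enorm (x k.+1 - x k) @[k --> \oo] --> b * enorm (xt - xt).
  apply: cvgMr; apply: continuous_cvg; first exact: continuous_enorm.
  by apply: cvgB => //; rewrite cvg_shiftS.
apply/eqP; rewrite eq_le enorm_ge0 andbT.
have := ler_cvg_to grad_xt step_xt.
rewrite subrr enorm0 mulr0; apply; near=> k; exact: grad_le_step.
Unshelve. all: by end_near. Qed.

Lemma dist_subdiff_cvg0 :
  (fun k => dist_to 0 (limiting_subdiff h (x k))) @ \oo --> 0%E.
Proof.
have [xt xxt grad0] := finite_length_cvg.
have grad_xt : (enorm (grad h (x k)))%:E @[k --> \oo] --> 0%:E.
  apply: cvg_EFin; first by near=> k.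
  rewrite -[X in _ --> X](@enorm0 R n) -grad0.
  apply: continuous_cvg; first exact: continuous_enorm.
  by apply: continuous_cvg; [exact: grad_cont|exact: xxt].
apply: (squeeze_cvge _ (cvg_cst 0%E) grad_xt); near=> k.
rewrite dist_to_ge0 /= -enormN -sub0r; apply: dist_to_le.
exact: grad_limiting_subdiff.
Unshelve. all: by end_near. Qed.

End finite_length.

(** * Lipschitz constants on balls, and estimates for a single step with g = 0 *)

Lemma lipschitz_on_ball (R : realType) (n : nat) (F : 'rV[R]_n -> 'rV[R]_n) r :
  lipschitz_on_bounded F ->
  exists2 K, 0 < K & forall y z, `|y| <= r -> `|z| <= r ->
    enorm (F y - F z) <= K * enorm (y - z).
Proof.
move=> /(_ [set y | `|y| <= r])[|K lipK].
  by exists r; split; rewrite ?num_real // => M rM y /= /le_trans-> //; exact: ltW.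
(* The maximum with 1 makes the constant positive, so that it can serve as a divisor. *)
exists (Num.max K 1) => [|y z yr zr]; first by rewrite lt_max ltr01 orbT.
by rewrite (le_trans (lipK _ _ yr zr)) // ler_wpM2r ?enorm_ge0 // le_max lexx.
Qed.

Section step.
Context {R : realType} {n : nat}.
Variables (f g phi : 'rV[R]_n -> \bar R) (alpha lambda s : R).
Hypotheses (alpha01 : 0 < alpha < 1) (lambda0 : 0 < lambda) (s0 : 0 < s).
Hypothesis g0 : forall u, g u = 0%E.
Hypothesis ffin : forall y, f y \is a fin_num.
Hypothesis df : forall y, differentiable (fine \o f) y.
Hypothesis hess_ge : forall x d, lambda * s * enorm d ^+ 2 <= hess_form phi x d.

Lemma PsiE : Psi f g = f.
Proof. by apply/funext => y; rewrite /Psi g0 adde0. Qed.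

(* Both orders of the arguments occur, so symmetry of the Hessian is not needed. *)
Lemma search_direction_stationary x d :
  search_direction setT f g phi lambda x d -> forall v,
  dot (grad f x) v = - ((2 * lambda)^-1 *
    (dot (d *m hess phi x) v + dot (v *m hess phi x) d)).
Proof.
move=> [_ dmin]; apply: quadratic_stationary => v.
have /dmin : [set d | closure setT (x + d)] v by rewrite closureT.
by rewrite !g0 !adde0 -!EFinD lee_fin.
Qed.

(** Stationarity tested at v = d gives -1/lambda times the Hessian form. *)
Lemma search_direction_descent x d :
  search_direction setT f g phi lambda x d ->
  dot (grad f x) d <= - (s * enorm d ^+ 2).
Proof.
move=> /search_direction_stationary/(_ d) ->; rewrite lerN2.
have := hess_ge x d; rewrite /hess_form => hd.
rewrite ler_pdivlMl ?mulr_gt0 //; lra.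
Qed.

Lemma rejectedE x d t : rejected f g alpha x d t <->
  fine (f x) + alpha * t * dot (grad f x) d < fine (f (x + t *: d)).
Proof.
rewrite /rejected PsiE !g0 adde0 sube0.
by rewrite -(fineK (ffin x)) -(fineK (ffin (x + t *: d))) -EFinM -EFinD lte_fin.
Qed.

(** Cauchy-Schwarz against the descent inequality. It confines all trial points to one ball once the
    gradients are bounded. *)
Lemma search_direction_enorm_le x d :
  search_direction setT f g phi lambda x d -> s * enorm d <= enorm (grad f x).
Proof.
move=> /search_direction_descent; have := dot_le_enorm (grad f x) (- d).
rewrite dotNr enormN => H1 H2.
have {H1 H2} : s * enorm d ^+ 2 <= enorm (grad f x) * enorm d by lra.
have [->|d0] := eqVneq (enorm d) 0; first by move=> _; rewrite mulr0 enorm_ge0.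
by rewrite expr2 mulrA ler_pM2r // lt_neqAle eq_sym d0 enorm_ge0.
Qed.

(** By the mean value theorem, f grows by at most t <grad f(x), d> + K t^2 |d|^2. Rejection and the
    descent inequality then force (1 - alpha) s |d|^2 < K t |d|^2. *)
Lemma rejected_gt x d t K : search_direction setT f g phi lambda x d ->
  0 < K -> 0 < t <= 1 ->
  (forall c, 0 <= c <= 1 ->
    enorm (grad f (x + c *: d) - grad f x) <= K * enorm (c *: d)) ->
  rejected f g alpha x d t -> (1 - alpha) * s / K < t.
Proof.
move=> /search_direction_descent desc K0 /andP[t0 t1] lipf /rejectedE rej.
have [c /andP[c0 c1]] := mean_value_grad x (t *: d) df.
rewrite dotZr scalerA => mv.
have ct01 : 0 <= c * t <= 1.
  by apply/andP; split; [rewrite mulr_ge0 // ltW|rewrite mulr_ile1 // ltW].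
have Kd : dot (grad f (x + (c * t) *: d)) d <= dot (grad f x) d + K * t * enorm d ^+ 2.
  rewrite -lerBlDl -dotNl -dotDl; apply: le_trans (dot_le_enorm _ _) _.
  rewrite expr2 mulrA ler_wpM2r ?enorm_ge0 //; apply: le_trans (lipf _ ct01) _.
  rewrite enormZ ger0_norm; last by case/andP: ct01.
  rewrite mulrA ler_wpM2r ?enorm_ge0 // ler_pM2l //.
  by rewrite ler_piMl ?ltW.
have : t * ((1 - alpha) * (s * enorm d ^+ 2)) < t * (K * t * enorm d ^+ 2).
  have : t * dot (grad f (x + (c * t) *: d)) d <=
      t * (dot (grad f x) d + K * t * enorm d ^+ 2) by rewrite ler_pM2l.
  have : 0 <= t * (1 - alpha) * (- (s * enorm d ^+ 2) - dot (grad f x) d).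
    by rewrite mulr_ge0 ?subr_ge0 // mulr_ge0 ?ltW // subr_gt0; case/andP: alpha01.
  lra.
rewrite ltr_pM2l // mulrA ltr_pdivrMr // => Kt.
(* The inequality is strict, so d is nonzero and its squared norm can be cancelled. *)
have d2 : 0 < enorm d ^+ 2.
  rewrite lt_neqAle sqr_ge0 andbT eq_sym; apply/eqP => d0.
  by move: Kt; rewrite d0 !mulr0 ltxx.
by move: Kt; rewrite ltr_pM2r // [K * t]mulrC.
Qed.

(** Stationarity tested at v = -grad f(x) gives |grad f(x)|^2 <= (M / lambda) |d| |grad f(x)|. *)
Lemma grad_le_direction x d M : search_direction setT f g phi lambda x d ->
  0 < M -> (forall d w, dot (d *m hess phi x) w <= M * (enorm d * enorm w)) ->
  enorm (grad f x) <= M / lambda * enorm d.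
Proof.
move=> /search_direction_stationary opt M0 hle.
have := opt (- grad f x); rewrite dotNr -sqr_enorm => /oppr_inj optE.
have := hle d (- grad f x); have := hle (- grad f x) d; rewrite enormN.
set G := enorm (grad f x) in optE *.
move=> H1 H2; have : G ^+ 2 <= M / lambda * enorm d * G.
  rewrite optE ler_pdivrMl ?mulr_gt0 //.
  have -> : 2 * lambda * (M / lambda * enorm d * G) = 2 * M * enorm d * G.
    by field; rewrite gt_eqF.
  lra.
have [G0|G0] := eqVneq G 0.
  by move=> _; rewrite G0 mulr_ge0 ?enorm_ge0 ?divr_ge0 ?ltW.
by rewrite expr2 ler_pM2r // lt_neqAle eq_sym G0 enorm_ge0.
Qed.

End step.

(** * Constants uniform along the generated sequence *)

Section iterates.
Context {R : realType} {n : nat}.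
Variables (f g phi : 'rV[R]_n -> \bar R) (eta alpha lambda s : R).
Variable x : nat -> 'rV[R]_n.
Hypotheses (eta01 : 0 < eta < 1) (alpha01 : 0 < alpha < 1).
Hypotheses (lambda0 : 0 < lambda) (s0 : 0 < s).
Hypothesis g0 : forall u, g u = 0%E.
Hypothesis ffin : forall y, f y \is a fin_num.
Hypothesis df : forall y, differentiable (fine \o f) y.
Hypothesis dgphi : forall y, differentiable (grad phi) y.
Hypothesis hess_ge : forall x d, lambda * s * enorm d ^+ 2 <= hess_form phi x d.
Hypothesis lipf : lipschitz_on_bounded (grad f).
Hypothesis lipphi : lipschitz_on_bounded (grad phi).
Hypothesis levelf : level_bounded f.
Hypothesis stepx : forall k, abpg_step setT f g phi eta alpha lambda (x k) (x k.+1).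

Let eta0 : 0 < eta. Proof. by case/andP: eta01. Qed.
Let alpha0 : 0 < alpha. Proof. by case/andP: alpha01. Qed.

Let etaX01 j : 0 < eta ^+ j <= 1.
Proof. by rewrite exprn_gt0 //= exprn_ile1 ?ltW //; case/andP: eta01. Qed.

Lemma abpg_step_decrease k d j :
  search_direction setT f g phi lambda (x k) d ->
  ~ rejected f g alpha (x k) d (eta ^+ j) ->
  alpha * s * (eta ^+ j * enorm d ^+ 2) <=
    fine (f (x k)) - fine (f (x k + eta ^+ j *: d)).
Proof.
move=> /(search_direction_descent lambda0 g0 hess_ge) desc.
move=> /(rejectedE alpha g0 ffin) /negP; rewrite -leNgt => acc.
have : alpha * eta ^+ j * dot (grad f (x k)) d <=
    alpha * eta ^+ j * - (s * enorm d ^+ 2).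
  by rewrite ler_pM2l // mulr_gt0 //; case/andP: (etaX01 j).
lra.
Qed.

Lemma abpg_bounded : bounded_set (range x).
Proof.
have fx k : fine (f (x k)) <= fine (f (x 0%N)).
  elim: k => // k; apply: le_trans; have [d [j [sd _ acc ->]]] := stepx k.
  rewrite -subr_ge0; apply: le_trans (abpg_step_decrease sd acc).
  rewrite !mulr_ge0 ?enorm_ge0 ?(ltW s0) ?(ltW alpha0) //.
  by rewrite ltW //; case/andP: (etaX01 j).
have [M [Mreal HM]] := levelf (fine (f (x 0%N))).
exists M; split => // N MN _ [k _ <-]; apply: HM MN _ _.
by rewrite /= -(fineK (ffin (x k))) lee_fin.
Qed.

Lemma abpg_gradient_like : exists a b, [/\ 0 < a, 0 < b,
  forall k, a * enorm (x k.+1 - x k) ^+ 2 <= fine (f (x k)) - fine (f (x k.+1)) &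
  forall k, enorm (grad f (x k)) <= b * enorm (x k.+1 - x k)].
Proof.
have [r xr] : exists r, forall k, `|x k| < r.
  (* [M + 1] is a bound; one more unit makes it strict, as [hess_le] requires. *)
  have [M [_ HM]] := abpg_bounded; exists (M + 2) => k.
  by rewrite (@le_lt_trans _ _ (M + 1)) ?ltrD2l ?ltr1n //; apply: HM; [rewrite ltrDl|exists k].
have r0 : 0 < r by apply: le_lt_trans (xr 0%N).
have [M M0 lipM] := lipschitz_on_ball r lipphi.
have [K0 K00 lipK0] := lipschitz_on_ball r lipf.
(* Bound on the gradients along the iterates, by comparison with the origin; sqrt n converts the sup
   norm into the Euclidean one. *)
pose G := enorm (grad f 0) + K0 * (Num.sqrt n%:R * r).
have gradG k : enorm (grad f (x k)) <= G.
  rewrite -[grad f (x k)](subrK (grad f 0)) addrC (le_trans (enormD _ _)) // lerD2l.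
  apply: le_trans (lipK0 _ _ (ltW (xr k)) _) _; first by rewrite normr0 ltW.
  rewrite subr0 ler_pM2l // (le_trans (enorm_le_normr _)) // ler_wpM2l ?sqrtr_ge0 //.
  exact: ltW.
(* Since |d| <= G / s, this larger ball contains every segment from an iterate to its full-step
   trial point. *)
have [K K0' lipK] := lipschitz_on_ball (r + G / s) lipf.
(* The value 1 covers immediate acceptance. Otherwise the previous trial, larger by the factor 1 /
   eta, was rejected and exceeds (1 - alpha) s / K. *)
pose tau := Num.min 1 (eta * ((1 - alpha) * s / K)).
have tau0 : 0 < tau.
  rewrite lt_min ltr01 mulr_gt0 // divr_gt0 // mulr_gt0 // subr_gt0.
  by case/andP: alpha01.
have G0 : 0 <= G by apply: le_trans (gradG 0%N); exact: enorm_ge0.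
have step_ge k d j : search_direction setT f g phi lambda (x k) d ->
    (forall i, (i < j)%N -> rejected f g alpha (x k) d (eta ^+ i)) ->
    tau <= eta ^+ j.
  move=> sd; case: j => [_|j /(_ j (leqnn _)) rej].
    by rewrite expr0 ge_min lexx.
  rewrite ge_min; apply/orP; right; rewrite exprS ler_pM2l // ltW //.
  apply: (rejected_gt alpha01 lambda0 g0 ffin df hess_ge sd K0' (etaX01 j) _ rej).
  move=> c /andP[c0 c1].
  have xr' : `|x k| <= r + G / s.
    by rewrite (le_trans (ltW (xr k))) // lerDl divr_ge0 // ltW.
  have xcdr : `|x k + c *: d| <= r + G / s.
    rewrite (le_trans (ler_normD _ _)) // lerD ?(ltW (xr k)) //.
    rewrite normrZ ger0_norm // (le_trans (ler_piMl _ c1)) //.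
    rewrite (le_trans (normr_le_enorm _)) // ler_pdivlMr // mulrC.
    by rewrite (le_trans (search_direction_enorm_le lambda0 g0 hess_ge sd)).
  by have := lipK _ _ xcdr xr'; rewrite [x k + _ - x k]addrC addKr.
(* In b, the factor 1 / tau converts |d| into the actual step eta^j |d|; in a, it suffices that
   eta^(2j) <= eta^j. *)
exists (alpha * s), (M / lambda / tau); split => [||k|k].
- exact: mulr_gt0.
- by rewrite !divr_gt0.
- have [d [j [sd _ acc xE]]] := stepx k.
  have := abpg_step_decrease sd acc; rewrite -xE; apply: le_trans.
  have /andP[t0 t1] := etaX01 j.
  rewrite xE [x k + _ - x k]addrC addKr enormZ gtr0_norm // exprMn.
  rewrite ler_pM2l ?mulr_gt0 // ler_wpM2r ?sqr_ge0 //.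
  by rewrite expr2 ler_piMl // ltW.
- have [d [j [sd rej acc xE]]] := stepx k.
  have /andP[t0 t1] := etaX01 j.
  have hle e w : dot (e *m hess phi (x k)) w <= M * (enorm e * enorm w).
    exact: (hess_le e w (dgphi (x k)) (xr k) lipM).
  apply: le_trans (grad_le_direction lambda0 g0 sd M0 hle) _.
  rewrite xE [x k + _ - x k]addrC addKr enormZ gtr0_norm //.
  rewrite -[leRHS]mulrA ler_pM2l ?divr_gt0 //.
  by rewrite ler_pdivlMl // ler_wpM2r ?enorm_ge0 // (step_ge _ _ _ sd).
Qed.

End iterates.

(** * Convergence of the algorithm when g vanishes *)

Unset Implicit Arguments.

Theorem theorem22 (R : realType) (n : nat)
    (f g phi : 'rV[R]_n -> \bar R)
    (hA : assumption_A setT f g phi)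
    (hB : assumption_B setT f g phi)
    (hC : assumption_C setT f phi)
    (hD : assumption_D setT phi)
    (hE : assumption_E f g phi)
    (hKL : KL_function (Psi f g))
    (eta alpha lambda : R)
    (heta : 0 < eta < 1) (halpha : 0 < alpha < 1) (hlambda : 0 < lambda)
    (x : nat -> 'rV[R]_n)
    (hx : abpg_sequence setT f g phi eta alpha lambda x)
    (hg : forall u, g u = 0%E) :
  (fun k => dist_to 0 (limiting_subdiff (Psi f g) (x k))) @ \oo --> 0%E /\
  (exists xt : 'rV[R]_n,
     x @ \oo --> xt /\ limiting_subdiff (Psi f g) xt 0) /\
  (\sum_(1 <= k <oo) (enorm (x k - x k.-1))%:E < +oo)%E.
Proof.
have [sigma sigma0 sc] := hD; have [lipf lipphi] := hE.
move: hKL; rewrite (PsiE _ hg) => KLf levelf.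
have ffin y : f y \is a fin_num by have [] := A_f_C1 hA (x := y) I.
have df y : differentiable (fine \o f) y by have [] := A_f_C1 hA (x := y) I.
have gradf : continuous (grad f) by move=> y; have [] := A_f_C1 hA (x := y) I.
have [C1phi C2phi] := A_C2 hA.
have phifin y : phi y \is a fin_num by have [] := C1phi y I.
have dphi y : differentiable (fine \o phi) y by have [] := C1phi y I.
have dgphi y : differentiable (grad phi) y by have [] := C2phi y I.
(* The Hessian form is at least sigma / 2 times |d|^2; dividing by lambda makes s the constant in
   <grad f(x), d> <= -s |d|^2. *)
pose s := sigma / 2 / lambda.
have s0 : 0 < s by rewrite !divr_gt0.
have hess_ge y d : lambda * s * enorm d ^+ 2 <= hess_form phi y d.
  have -> : lambda * s = sigma / 2 by rewrite mulrC divfK // gt_eqF.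
  exact: hess_form_ge.
have [_ stepx] := hx.
have bounded := abpg_bounded heta halpha hlambda s0 hg ffin hess_ge levelf stepx.
have [a [b [a0 b0 decr grad_le]]] := abpg_gradient_like heta halpha hlambda s0
  hg ffin df dgphi hess_ge lipf lipphi levelf stepx.
split; first exact: (dist_subdiff_cvg0 a0 b0 ffin df gradf bounded decr grad_le KLf).
split; last exact: (finite_length a0 b0 ffin df bounded decr grad_le KLf).
have [xt xxt grad0] :=
  finite_length_cvg a0 b0 ffin df gradf bounded decr grad_le KLf.
exists xt; split => //; rewrite -grad0; exact: grad_limiting_subdiff.
Qed.
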